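(* Let $\tau>0$. Assume the distributions of a real random variable $z$ under the null and alternative hypotheses are described by $$H_0:\ z\sim N(0,1),\qquad\qquad H_1:\ z\mid\lambda\sim N(\lambda,1),\quad \lambda\mid\tau^2\sim J(0,\tau^2).$$ Then, for every $z\in\mathbb{R}$, the Bayes factor in favor of the alternative hypothesis is $$BF_{10}(z\mid\tau^2)=(\tau^2+1)^{-3/2}\left(1+\frac{\tau^2z^2}{\tau^2+1}\right)\exp\left[\frac{\tau^2z^2}{2(\tau^2+1)}\right].$$
   Context: $N(a,b)$ denotes the normal distribution with mean $a$ and variance $b$. $J(\mu_0,\tau^2)$ (with $\tau>0$) denotes the normal moment distribution on $\mathbb{R}$, with density $$j(x\mid\mu_0,\tau^2)=\frac{(x-\mu_0)^2}{\sqrt{2\pi}\,\tau^3}\exp\left(-\frac{(x-\mu_0)^2}{2\tau^2}\right).$$ The hyperparameter $\tau^2$ is a fixed constant. The Bayes factor in favor of the alternative hypothesis based on a test statistic $x$ is $BF_{10}(x\mid\tau^2)=m_1(x\mid\tau^2)/m_0(x)$, where $m_0(x)$ is the density of the statistic under $H_0$, and $m_1(x\mid\tau^2)=\int f(x\mid\lambda)\,\pi(\lambda\mid\tau^2)\,d\lambda$ is its marginal density under $H_1$. Here $f(x\mid\lambda)$ is the density of the statistic given $\lambda$ under $H_1$ and $\pi(\lambda\mid\tau^2)$ is the prior density of $\lambda$ under $H_1$. *)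

(* Defs.v *)
From HB Require Import structures.
From mathcomp Require Import all_boot all_order all_algebra.
From mathcomp Require Import all_classical all_reals all_analysis.

Set Implicit Arguments.
Unset Strict Implicit.
Unset Printing Implicit Defensive.

Import Order.TTheory GRing.Theory Num.Theory.
Import numFieldNormedType.Exports.

Local Open Scope ring_scope.

(* The density of J(mu, tau^2). As for [normal_pdf], the second parameter is
   the scale tau itself, not tau^2; it is meant for 0 < tau. *)
Definition normal_moment_pdf (R : realType) (mu tau x : R) : R :=
  (x - mu) ^+ 2 / (Num.sqrt (2 * pi) * tau ^+ 3) *
  expR (- ((x - mu) ^+ 2 / (2 * tau ^+ 2))).

(* [f l] is the density of the statistic given the parameter [l], and [prior]
   the density of the parameter. The integral is kept in \bar R so that a
   divergent marginal is +oo rather than a junk real. *)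
Definition marginal_pdf (R : realType) (f : R -> R -> R) (prior : R -> R)
    (x : R) : \bar R :=
  (\int[lebesgue_measure]_l (f l x * prior l)%:E)%E.

Definition bayes_factor (R : realType) (m0 : R -> R) (f : R -> R -> R)
    (prior : R -> R) (x : R) : \bar R :=
  (marginal_pdf f prior x / (m0 x)%:E)%E.

(* Main.v *)
Require Import Defs.
From HB Require Import structures.
From mathcomp Require Import all_boot all_order all_algebra.
From mathcomp Require Import all_classical all_reals all_analysis.
From mathcomp Require Import measurable_realfun ring.

Set Implicit Arguments.
Unset Strict Implicit.
Unset Printing Implicit Defensive.

Import Order.TTheory GRing.Theory Num.Theory.
Import numFieldNormedType.Exports.

Import gauss_integral_proof.

Local Open Scope ring_scope.

(* The prior density is tau^-2 lambda^2 times the N(0, tau^2) density. By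
   conjugacy, N(z; lambda, 1) N(lambda; 0, tau^2) = N(z; 0, tau^2 + 1)
   N(lambda; tau^2 z / (tau^2 + 1), tau^2 / (tau^2 + 1)), so the marginal is
   tau^-2 N(z; 0, tau^2 + 1) times the second moment m^2 + s^2 of a normal
   distribution. That moment reduces to the integral of (m + c x)^2 exp(-x^2),
   whose integrand is, on the half line, the derivative of a combination of
   exp(-x^2), x exp(-x^2) and the integral of exp(-t^2) over [0, x]. *)

(** * The function exp(-x^2) and its integral over [0, x] *)

Lemma is_derive_gauss_fun (R : realType) (x : R) :
  is_derive x 1 (@gauss_fun R) (- (2 * x * gauss_fun x)).
Proof.
rewrite /gauss_fun; apply: is_derive_eq.
by rewrite scaler1 /GRing.scale /=; ring.
Qed.

Lemma cvg_mulr_gauss_fun (R : realType) :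
  (x * gauss_fun x @[x --> +oo] --> (0 : R))%classic.
Proof.
apply: (@squeeze_cvgr _ _ _ _ (fun=> 0) (fun x : R => x^-1)).
- near=> x.
  have x0 : 0 < x by near: x; exact: nbhs_pinfty_gt.
  rewrite mulr_ge0 ?gauss_fun_ge0 ?(ltW x0)//= /gauss_fun expRN.
  rewrite ler_pdivrMr ?expR_gt0// ler_pdivlMl//.
  (* The upper bound 1 / x comes from x^2 <= 1 + x^2 <= exp(x^2). *)
  by rewrite -expr2 (le_trans _ (expR_ge1Dx _))// lerDr.
- exact: cvg_cst.
- apply/gtr0_cvgV0; last exact: cvg_id.
  by exact: nbhs_pinfty_gt.
Unshelve. all: by end_near. Qed.

Lemma integral0_gauss0 (R : realType) : integral0_gauss 0 = 0 :> R.
Proof. by rewrite /integral0_gauss set_itv1 Rintegral_set1. Qed.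

(** The square of the integral is known to tend to pi / 4; the integral is nonnegative, so
    continuity of the square root gives its own limit. *)
Lemma cvg_integral0_gauss (R : realType) :
  (@integral0_gauss R x @[x --> +oo] --> Num.sqrt pi / 2)%classic.
Proof.
have -> : Num.sqrt pi / 2 = Num.sqrt (pi / 4) :> R.
  rewrite sqrtrM ?pi_ge0// sqrtrV// (_ : 4 = 2 ^+ 2) ?sqrtr_sqr ?ger0_norm//.
  by ring.
rewrite (_ : @integral0_gauss R = (fun x => Num.sqrt (integral0_gauss x ^+ 2))); last first.
  by apply/funext => x; rewrite sqrtr_sqr ger0_norm// integral0_gauss_ge0.
by apply: continuous_cvg; [exact: sqrt_continuous|exact: cvg_integral0_gauss_sqr].
Qed.

Lemma integrable_gauss_itv (R : realType) (a b : R) :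
  (@lebesgue_measure R).-integrable `[a, b]%classic (EFin \o @gauss_fun R).
Proof.
by apply: (integrableS measurableT _ (@subsetT _ _)) => //; exact: integrableT_gauss.
Qed.

Lemma is_derive_integral0_gauss (R : realType) (x : R) : 0 < x ->
  is_derive x 1 (@integral0_gauss R) (gauss_fun x).
Proof.
move=> x0.
(* The endpoint [x + 1] only serves to make [x] interior to the interval. *)
have [] := @continuous_FTC1_closed R (@gauss_fun R) 0 x (x + 1) _
  (integrable_gauss_itv _ _) x0 (@continuous_gauss_fun R x).
  by rewrite ltrDl.
by move=> dH; rewrite derive1E => <-; exact/derivableP.
Qed.

Lemma cvg_integral0_gauss0 (R : realType) :
  (@integral0_gauss R x @[x --> (0 : R)] --> (0 : R))%classic.
Proof.
apply: (@parameterized_integral_cvg_left R 0 1 (@gauss_fun R)) => //.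
exact: integrable_gauss_itv.
Qed.

(** * Integrals of (m + c x)^2 exp(-x^2) *)

Lemma continuous_sqr_gauss_fun (R : realType) (m c : R) :
  continuous (fun x => (m + c * x) ^+ 2 * gauss_fun x).
Proof.
move=> x; apply: cvgM; last exact: continuous_gauss_fun.
apply: (cvg_comp (fun x => m + c * x) (fun y => y ^+ 2)); last first.
  exact: exprn_continuous.
by apply: cvgD; [exact: cvg_cst|apply: cvgMl_tmp; exact: cvg_id].
Qed.

Lemma integral0y_sqr_gauss_fun (R : realType) (m c : R) :
  (\int[lebesgue_measure]_(x in `[0%R, +oo[) ((m + c * x) ^+ 2 * gauss_fun x)%:E =
   ((m ^+ 2 + c ^+ 2 / 2) * (Num.sqrt pi / 2) + m * c)%:E)%E.
Proof.
(* Expand the square and write g for [gauss_fun], H for [integral0_gauss]: m^2 g, 2 m c x g and c^2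
   x^2 g have primitives m^2 H, - m c g and (c^2 / 2) (H - x g), the last by parts. *)
pose F (x : R) := (m ^+ 2 + c ^+ 2 / 2) * integral0_gauss x - m * c * gauss_fun x
  - c ^+ 2 / 2 * (x * gauss_fun x).
have dF (x : R) : 0 < x -> is_derive x 1 F ((m + c * x) ^+ 2 * gauss_fun x).
  move=> x0; have dH := is_derive_integral0_gauss x0.
  have dg := is_derive_gauss_fun x.
  rewrite /F; apply: is_derive_eq.
  by rewrite /GRing.scale /=; field.
rewrite (@ge0_continuous_FTC2y _ _ F 0 ((m ^+ 2 + c ^+ 2 / 2) * (Num.sqrt pi / 2))).
- rewrite /F integral0_gauss0 /gauss_fun mul0r !mulr0 expr0n /= oppr0 expR0.
  by rewrite -EFinB; congr EFin; ring.
- by move=> x _; rewrite mulr_ge0 ?sqr_ge0 ?gauss_fun_ge0.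
- exact/continuous_subspaceT/continuous_sqr_gauss_fun.
- set l := (X in cvg_to _ (nbhs X)).
  (* The two zeros are the limits of [gauss_fun x] and [x * gauss_fun x] at infinity. *)
  rewrite (_ : l = l - m * c * 0 - c ^+ 2 / 2 * 0); last by ring.
  apply: cvgB; [apply: cvgB|]; apply: cvgMl_tmp.
  + exact: cvg_integral0_gauss.
  + exact: cvg_gauss_fun.
  + exact: cvg_mulr_gauss_fun.
- by move=> x /dF [].
- apply: cvg_at_right_filter; rewrite /F.
  apply: cvgB; [apply: cvgB|]; apply: cvgMl_tmp.
  + rewrite integral0_gauss0; exact: cvg_integral0_gauss0.
  + exact: continuous_gauss_fun.
  + by apply: cvgM; [exact: cvg_id|exact: continuous_gauss_fun].
- by move=> x; rewrite in_itv/= andbT => /dF dFx; rewrite derive1E derive_val.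
Qed.

(** Reflecting the negative half line replaces c by - c, so the boundary terms m c of the two halves
    cancel. *)
Lemma integral_sqr_gauss_fun (R : realType) (m c : R) :
  (\int[lebesgue_measure]_x ((m + c * x) ^+ 2 * gauss_fun x)%:E =
   ((m ^+ 2 + c ^+ 2 / 2) * Num.sqrt pi)%:E)%E.
Proof.
have f0 (d x : R) : 0 <= (m + d * x) ^+ 2 * gauss_fun x.
  by rewrite mulr_ge0 ?sqr_ge0 ?gauss_fun_ge0.
have cf d := @continuous_sqr_gauss_fun R m d.
have mf : measurable_fun [set: R]%classic
    (fun x => (m + c * x) ^+ 2 * gauss_fun x).
  apply: continuous_measurable_fun; exact: cf.
rewrite -(setUv `[(0 : R), +oo[%classic) ge0_integral_setU//=; last 4 first.
- exact: measurableC.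
- by rewrite setUv; exact/measurable_EFinP.
- by move=> x _; rewrite lee_fin.
- exact/disj_setPCl.
rewrite setCitvr integral_itv_bndo_bndc; last first.
  exact/measurable_EFinP/measurable_funTS.
(* The endpoint 0 is written as - 0 to fit the substitution x -> - x. *)
rewrite -{2}oppr0 ge0_integration_by_substitutionNy//; last first.
  exact: continuous_subspaceT.
under [X in (_ + X)%E]eq_integral => x _.
  rewrite /= /gauss_fun sqrrN mulrN -mulNr -/(gauss_fun x).
  over.
rewrite !integral0y_sqr_gauss_fun -EFinD; congr EFin.
by field.
Qed.

(** * Second moment of a normal distribution *)

Lemma normal_fun_gauss_fun (R : realType) (m s x : R) : s != 0 ->
  normal_fun m s x = gauss_fun ((x - m) / (Num.sqrt 2 * s)).
Proof.
move=> s0; rewrite /normal_fun /gauss_fun exprMn exprVn exprMn sqr_sqrtr//.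
by rewrite mulNr mulr_natl.
Qed.

Lemma normal_peakE (R : realType) (s : R) : 0 < s ->
  normal_peak s = (s * Num.sqrt (2 * pi))^-1.
Proof.
move=> s0; rewrite /normal_peak -mulrnAr sqrtrM ?sqr_ge0// sqrtr_sqr.
by rewrite gtr0_norm// mulr_natl.
Qed.

Lemma integral_sqr_normal_pdf (R : realType) (m s : R) : 0 < s ->
  (\int[lebesgue_measure]_x (x ^+ 2 * normal_pdf m s x)%:E =
   (m ^+ 2 + s ^+ 2)%:E)%E.
Proof.
(* With this c, ((x - m) / c)^2 is the exponent of the normal density up to sign, and c^2 / 2 =
   s^2. *)
move=> s0; set c := Num.sqrt 2 * s.
have c0 : 0 < c by rewrite mulr_gt0// sqrtr_gt0.
have cE : c ^+ 2 = 2 * s ^+ 2 by rewrite exprMn sqr_sqrtr.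
pose F (x : R) := (x - m) / c.
have dF (x : R) : is_derive x 1 F c^-1.
  by rewrite /F; apply: is_derive_eq; rewrite scaler0 add0r subr0 scaler1.
have F'E : F^`()%classic = cst c^-1.
  by apply/funext => x; rewrite derive1E derive_val.
(* The substitution is made in the known Gaussian integral: putting F x for its variable turns m + c
   F x into x. *)
have := integral_sqr_gauss_fun m c.
rewrite (@increasing_ge0_integration_by_substitutionT _ F); last 9 first.
- by move=> x y xy; rewrite /F ltr_pM2r ?invr_gt0// ltrD2r.
- by rewrite F'E => ?; exact: cvg_cst.
- by rewrite F'E; exact: is_cvg_cst.
- by rewrite F'E; exact: is_cvg_cst.
- by move=> x; case: (dF x).
- by apply/gt0_cvgMlNy; [rewrite invr_gt0|exact: cvg_addrr_Ny].
- by apply/gt0_cvgMly; [rewrite invr_gt0|exact: cvg_addrr].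
- exact: continuous_sqr_gauss_fun.
- by move=> x; rewrite mulr_ge0 ?sqr_ge0 ?gauss_fun_ge0.
have pE : normal_peak s = (c * Num.sqrt pi)^-1.
  by rewrite normal_peakE// sqrtrM// mulrCA mulrA.
have sp0 : 0 < Num.sqrt pi :> R by rewrite sqrtr_gt0 pi_gt0.
under eq_integral => x _.
  rewrite !fctE F'E /= (_ : _ / c = Num.sqrt pi * (x ^+ 2 * normal_pdf m s x)).
    rewrite EFinM; over.
  rewrite normal_pdfE ?gt_eqF// normal_fun_gauss_fun ?gt_eqF// pE -/c -/(F x).
  have -> : m + c * F x = x by rewrite /F; field; rewrite gt_eqF.
  by field; rewrite !gt_eqF.
rewrite ge0_integralZl//=; last 2 first.
- apply/measurable_EFinP/measurable_funM; last exact: measurable_normal_pdf.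
  exact: measurable_funX.
- by move=> x _; rewrite lee_fin mulr_ge0 ?sqr_ge0 ?normal_pdf_ge0.
move=> /(congr1 (mule (Num.sqrt pi)^-1%:E)).
rewrite muleA -!EFinM mulVf ?gt_eqF// mul1e => ->.
by congr EFin; rewrite cE; field; rewrite gt_eqF.
Qed.

(** * Conjugacy and the Bayes factor *)

Lemma normal_pdf_conjugate (R : realType) (tau l z : R) : 0 < tau ->
  normal_pdf l 1 z * normal_pdf 0 tau l =
  normal_pdf 0 (Num.sqrt (tau ^+ 2 + 1)) z *
  normal_pdf (tau ^+ 2 * z / (tau ^+ 2 + 1)) (tau / Num.sqrt (tau ^+ 2 + 1)) l.
Proof.
move=> tau0; set r := Num.sqrt (tau ^+ 2 + 1).
have w0 : 0 < tau ^+ 2 + 1 by rewrite ltr_wpDl ?sqr_ge0.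
have r0 : 0 < r by rewrite sqrtr_gt0.
have r2 : r ^+ 2 = tau ^+ 2 + 1 by rewrite sqr_sqrtr// ltW.
have q0 : 0 < Num.sqrt (2 * pi) :> R by rewrite sqrtr_gt0 mulr_gt0 ?pi_gt0.
rewrite !normal_pdfE ?gt_eqF ?divr_gt0//.
rewrite /= !normal_peakE ?divr_gt0//.
rewrite /normal_fun mulrACA -expRD [RHS]mulrACA -expRD; congr (_ * expR _).
  by field; rewrite !gt_eqF.
(* Completing the square in l: (z - l)^2 + l^2 / tau^2 = z^2 / r^2 + (r^2 / tau^2) (l - tau^2 z /
   r^2)^2. *)
rewrite expr_div_n r2.
by field; rewrite !gt_eqF.
Qed.

Lemma normal_moment_pdf0E (R : realType) (tau l : R) : 0 < tau ->
  normal_moment_pdf 0 tau l = (tau ^+ 2)^-1 * (l ^+ 2 * normal_pdf 0 tau l).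
Proof.
move=> tau0; rewrite normal_pdfE ?gt_eqF// /normal_moment_pdf /= normal_peakE//.
have q0 : 0 < Num.sqrt (2 * pi) :> R by rewrite sqrtr_gt0 mulr_gt0 ?pi_gt0.
rewrite /normal_fun subr0 mulNr -[tau ^+ 2 *+ 2]mulr_natl.
by field; rewrite !gt_eqF.
Qed.

Theorem theorem1 (R : realType) (tau : R) (tau_gt0 : 0 < tau) (z : R) :
  bayes_factor (normal_pdf 0 1) (fun lambda => normal_pdf lambda 1)
    (normal_moment_pdf 0 tau) z =
  ((tau ^+ 2 + 1) `^ (- (3 / 2)) *
   (1 + tau ^+ 2 * z ^+ 2 / (tau ^+ 2 + 1)) *
   expR (tau ^+ 2 * z ^+ 2 / (2 * (tau ^+ 2 + 1))))%:E.
Proof.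
set w := tau ^+ 2 + 1; pose r := Num.sqrt w.
have w0 : 0 < w by rewrite ltr_wpDl ?sqr_ge0.
have r0 : 0 < r by rewrite sqrtr_gt0.
have r2 : r ^+ 2 = w by rewrite sqr_sqrtr// ltW.
have marginalE : marginal_pdf (fun lambda => normal_pdf lambda 1)
    (normal_moment_pdf 0 tau) z =
    (normal_pdf 0 r z / tau ^+ 2 * ((tau ^+ 2 * z / w) ^+ 2 + (tau / r) ^+ 2))%:E.
  rewrite /marginal_pdf.
  under eq_integral => l _.
    rewrite normal_moment_pdf0E// mulrCA [X in _ * X]mulrCA normal_pdf_conjugate//.
    rewrite -/w -/r [X in _ * X]mulrCA mulrA [_^-1 * _]mulrC EFinM; over.
  rewrite ge0_integralZl//=; last 3 first.
  - apply/measurable_EFinP/measurable_funM; last exact: measurable_normal_pdf.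
    exact: measurable_funX.
  - by move=> x _; rewrite lee_fin mulr_ge0 ?sqr_ge0 ?normal_pdf_ge0.
  - by rewrite lee_fin divr_ge0 ?sqr_ge0 ?normal_pdf_ge0.
  by rewrite integral_sqr_normal_pdf ?divr_gt0// -EFinM.
have peak0 : 0 < normal_peak 1 :> R by rewrite normal_peak_gt0.
(* Positivity makes the inverse in [\bar R] the real inverse, away from its value at 0. *)
have m0 : 0 < normal_pdf 0 1 z.
  by rewrite normal_pdfE// mulr_gt0 ?expR_gt0.
rewrite /bayes_factor marginalE inver gt_eqF// -EFinM; congr EFin.
(* One factor 1 / r comes from [normal_peak r], the other two from the second moment, which equals
   (tau^2 / w) (1 + tau^2 z^2 / w). *)
have powE : w `^ (- (3 / 2)) = (r ^+ 3)^-1.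
  rewrite powRN; congr _^-1.
  by rewrite mulrC powRrM powR12_sqrt ?ltW// powR_mulrn// sqrtr_ge0.
have peakE : normal_peak r = normal_peak 1 / r.
  by rewrite !normal_peakE// mul1r invfM mulrC.
(* The exponential factor of the result arises from 1 - 1 / w = tau^2 / w. *)
have expE : normal_fun 0 r z =
    normal_fun 0 1 z * expR (tau ^+ 2 * z ^+ 2 / (2 * w)).
  rewrite /normal_fun -expRD r2; congr expR.
  by rewrite /w; field; rewrite gt_eqF.
have f0 : 0 < normal_fun 0 1 z by exact: expR_gt0.
rewrite powE normal_pdfE ?gt_eqF// normal_pdfE// peakE expE -r2.
by field; rewrite !gt_eqF.
Qed.
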